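(* Let $A$ be a $d$-dimensional extremal $(0,1)$-matrix of order $n$ with deficiency $\delta$, and let $\Lambda=(\lambda_{i,j})$ be an optimal hyperplane cover of $A$. Let $\Lambda'$ be a $d\times(n+1)$ table obtained from $\Lambda$ by appending one new column (the $(n+1)$-st entry of each row) in one of the following three ways: (1) choose an index $\alpha$ covered by $\Lambda$ with weight exactly $1$, and append the entry $\lambda_{i,\alpha_i}$ to the $i$-th row for every $i=1,\dots,d$; (2) append the entry $1$ to one row and the entry $0$ to all other rows; (3) if some row $j$ of $\Lambda$ contains an entry equal to $\delta$, append $1-\delta$ to some row $i\neq j$, append $\delta$ to row $j$, and append $0$ to all other rows. Then $\Lambda'$ is an optimal hyperplane cover of the matrix $B=A(\Lambda')$, and $B$ is a $d$-dimensional extremal matrix of order $n+1$ with deficiency $\delta$.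
   Context: A $d$-dimensional matrix of order $n$ is an array $(a_\alpha)_{\alpha\in\{1,\dots,n\}^d}$; $\mathrm{supp}(A)=\{\alpha:a_\alpha\ne0\}$; the hyperplane $\Gamma_{i,j}$ is the set of indices with $\alpha_i=j$. A polyplex of weight $W$ is a nonnegative matrix $K$ of order $n$ whose entries sum to at most $1$ over each hyperplane and to $W$ in total; a polydiagonal is a polyplex of weight $n$. A $(0,1)$-matrix $A$ contains $K$ if $\mathrm{supp}(K)\subseteq\mathrm{supp}(A)$. A hyperplane cover of $A$ is a nonnegative $d\times n$ table $\Lambda=(\lambda_{i,j})$ with $\sum_{i=1}^d\lambda_{i,\alpha_i}\ge1$ for all $\alpha\in\mathrm{supp}(A)$; its weight is the sum of its entries; it is optimal if it has minimum weight among hyperplane covers of $A$. An index $\alpha$ is covered by $\Lambda$ with weight $\sum_i\lambda_{i,\alpha_i}$. For a nonnegative $d\times m$ table $\Lambda$, $A(\Lambda)$ is the $d$-dimensional $(0,1)$-matrix of order $m$ whose support is $\{\alpha\in\{1,\dots,m\}^d:\sum_{i=1}^d\lambda_{i,\alpha_i}\ge 1\}$. A $(0,1)$-matrix $A$ is extremal if it contains no polydiagonal, but for every index $\alpha$ with $a_\alpha=0$ the matrix obtained by changing $a_\alpha$ to $1$ contains a polydiagonal. The deficiency of an extremal matrix of order $n$ is $n$ minus the maximum weight of a polyplex contained in it. *)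

(* Defs.v *)
From mathcomp Require Import all_boot all_order all_algebra.

Set Implicit Arguments.
Unset Strict Implicit.
Unset Printing Implicit Defensive.

Import Order.TTheory GRing.Theory Num.Theory.
Local Open Scope ring_scope.

Definition mdindex (d n : nat) := {ffun 'I_d -> 'I_n}.

(* d-dimensional matrices of order n; 'M[R]_(m, n) is kept for d x n tables. *)
Definition mdmatrix (R : Type) (d n : nat) := {ffun mdindex d n -> R}.

Section MultidimensionalMatrices.

Variables (R : realFieldType) (d n : nat).
Implicit Types (A K : mdmatrix R d n) (L : 'M[R]_(d, n)) (a : mdindex d n).

Definition supp A : {set mdindex d n} := [set a | A a != 0].

Definition hyperplane (i : 'I_d) (j : 'I_n) : {set mdindex d n} :=
  [set a : mdindex d n | a i == j].

Definition zero_one A : Prop := forall a, A a = 0 \/ A a = 1.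

Definition polyplex (W : R) K : Prop :=
  [/\ forall a, 0 <= K a,
      forall i j, \sum_(a in hyperplane i j) K a <= 1
    & \sum_a K a = W].

Definition polydiagonal K : Prop := polyplex n%:R K.

Definition contains A K : Prop := supp K \subset supp A.

Definition index_weight L a : R := \sum_i L i (a i).

Definition table_weight L : R := \sum_i \sum_j L i j.

Definition hyperplane_cover A L : Prop :=
  (forall i j, 0 <= L i j) /\ (forall a, a \in supp A -> 1 <= index_weight L a).

Definition optimal_cover A L : Prop :=
  hyperplane_cover A L /\
  (forall L', hyperplane_cover A L' -> table_weight L <= table_weight L').

Definition matrix_of_table L : mdmatrix R d n :=
  [ffun a => if 1 <= index_weight L a then 1 else 0].

Definition set_one A a : mdmatrix R d n :=
  [ffun b => if b == a then 1 else A b].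

Definition extremal A : Prop :=
  [/\ zero_one A,
      ~ (exists K, polydiagonal K /\ contains A K)
    & forall a, A a = 0 ->
        exists K, polydiagonal K /\ contains (set_one A a) K].

Definition max_polyplex_weight A (W : R) : Prop :=
  (exists K, polyplex W K /\ contains A K) /\
  (forall W' K, polyplex W' K -> contains A K -> W' <= W).

(* A relation, since the existence of a polyplex of maximum weight is a theorem. *)
Definition deficiency A (delta : R) : Prop :=
  exists W, max_polyplex_weight A W /\ delta = n%:R - W.

Definition append_index L (c : 'cV[R]_d) : Prop :=
  exists a, index_weight L a = 1 /\ forall i, c i 0 = L i (a i).

Definition append_unit (c : 'cV[R]_d) : Prop :=
  exists i, forall k, c k 0 = if k == i then 1 else 0.

Definition append_deficiency L (delta : R) (c : 'cV[R]_d) : Prop :=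
  exists i j, [/\ i != j, exists k, L j k = delta
    & forall k, c k 0 =
        if k == i then 1 - delta else if k == j then delta else 0].

End MultidimensionalMatrices.

(* Main.v *)
(* Testing an optimal cover L against the polydiagonals that extremality
   provides shows that zeros of A have weight at most 1 - delta. Hence A is the
   matrix of L, every row of L contains 0, and the nonzero entries of L are at
   least delta. The appended column has sum 1, so adding a unit mass at the new
   corner turns polyplexes of A into polyplexes of B; with LP duality this
   settles optimality and deficiency. Given a zero b of B, let S be the set of
   directions in which b lies in the new column. If every appended entry in S
   already occurs in its row of L, then b projects to a zero a of A, and the mass
   at a of a polydiagonal can be exchanged with the corner mass along S. This
   fails only in case (3) when S contains i but not j; there b has weight 1 - delta
   and zero entries outside S, and relabelling columns makes b the corner. *)
Require Import Defs.
From mathcomp Require Import all_boot all_order all_algebra all_fingroup.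
From mathcomp Require Import ring lra.

Set Implicit Arguments.
Unset Strict Implicit.
Unset Printing Implicit Defensive.

Import Order.TTheory GRing.Theory Num.Theory.
Local Open Scope ring_scope.

(** * Farkas' lemma *)

(* Bartl's induction on the number of forms: a point x0 refuting the smaller
   system but not the form i0 lets one project all forms along x0 onto the
   kernel of i0. *)
Lemma farkas (R : realFieldType) (I : eqType) (J : finType) (s : seq I)
    (a : I -> J -> R) (g : J -> R) :
  uniq s ->
  (exists k : I -> R, (forall i, 0 <= k i) /\
     forall j, g j = \sum_(i <- s) k i * a i j) \/
  (exists x : J -> R, (forall i, i \in s -> \sum_j x j * a i j <= 0) /\
     0 < \sum_j x j * g j).
Proof.
elim: s a g => [|i0 s IHs] a g /=.
  move=> _; have [/forallP g0|] := boolP [forall j, g j == 0].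
    by left; exists (fun=> 0); split=> // j; rewrite big_nil; apply/eqP.
  rewrite negb_forall => /existsP[j0 gj0]; right; exists g; split=> //.
  rewrite (bigD1 j0) //= ltr_wpDr ?sumr_ge0 // => [j _|].
    by rewrite -expr2 sqr_ge0.
  by rewrite -expr2 lt_def sqrf_eq0 gj0 sqr_ge0.
case/andP=> i0s us; case: (IHs a g us) => [[k [k0 kE]]|[x0 [x0a x0g]]].
  left; exists (fun i => if i == i0 then 0 else k i); split=> [i|j].
    by case: eqP.
  rewrite big_cons eqxx mul0r add0r kE; apply: eq_big_seq => i is_.
  by case: eqP is_ i0s => // -> ->.
pose dot (x f : J -> R) := \sum_j x j * f j.
have [le0|lt0] := leP (dot x0 (a i0)) 0.
  right; exists x0; split=> // i; rewrite inE => /predU1P[-> //|]; exact: x0a.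
pose r f := dot x0 f / dot x0 (a i0).
pose proj f j : R := f j - r f * a i0 j.
have dot_proj x f : dot x (proj f) = dot x f - r f * dot x (a i0).
  rewrite /dot mulr_sumr -sumrB; apply: eq_bigr => j _; rewrite /proj; ring.
case: (IHs (fun i => proj (a i)) (proj g) us) => [[k [k0 kE]]|[x [xa xg]]].
  (* [e] collects the multiples of [a i0] removed by the projections; it is nonnegative because
     [r g > 0] while [r (a i) <= 0] on [s]. *)
  left; pose e := r g - \sum_(i <- s) k i * r (a i).
  exists (fun i => if i == i0 then e else k i); split=> [i|j].
    case: eqP => // _; rewrite /e subr_ge0; apply: (@le_trans _ _ 0).
      rewrite big_seq sumr_le0 // => i' i's.
      by rewrite mulr_ge0_le0 // mulr_le0_ge0 ?invr_ge0 ?x0a // ltW.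
    by rewrite divr_ge0 // ltW.
  rewrite big_cons eqxx.
  under eq_big_seq => i is_.
    have /negPf -> : i != i0 by apply: contraNneq i0s => <-.
    over.
  have := kE j; rewrite /proj /=.
  under eq_bigr do rewrite mulrBr.
  rewrite sumrB => /eqP; rewrite subr_eq => /eqP ->.
  under [X in _ - X]eq_bigr do rewrite mulrA.
  by rewrite -mulr_suml /e; ring.
(* Shifted along [x0] until it vanishes on [a i0], the point pairs with [f] as [x] does with
   [proj f]. *)
right; pose t := dot x (a i0) / dot x0 (a i0).
exists (fun j => x j - t * x0 j).
have dotE f : \sum_j (x j - t * x0 j) * f j = dot x (proj f).
  rewrite dot_proj /dot.
  under eq_bigr do rewrite mulrBl -mulrA.
  by rewrite sumrB -mulr_sumr /t /r -!/(dot _ _); field; rewrite gt_eqF.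
split=> [i|]; rewrite dotE //.
rewrite inE => /predU1P[->|/xa //].
by rewrite dot_proj /r divff ?gt_eqF // mul1r subrr.
Qed.

(** * Linear programming duality between polyplexes and hyperplane covers *)

Section Duality.

Variables (R : realFieldType) (d n : nat).
Implicit Types (A K : mdmatrix R d n) (L : 'M[R]_(d, n)) (a b : mdindex d n).

Lemma supp_matrix_of_table L a :
  (a \in supp (matrix_of_table L)) = (1 <= index_weight L a).
Proof. by rewrite inE ffunE; case: ifP; rewrite ?oner_eq0 ?eqxx. Qed.

Lemma mass_out A K a : contains A K -> a \notin supp A -> K a = 0.
Proof.
by move=> /subsetP sKA aA; apply/eqP; apply: contraNT aA => Ka; rewrite sKA ?inE.
Qed.

(** Double counting: each product [K a * L i (a i)] is charged to the hyperplane of direction [i]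
    through [a]. *)
Lemma sum_mass_weight K L :
  \sum_a K a * index_weight L a =
  \sum_i \sum_j L i j * \sum_(a in hyperplane i j) K a.
Proof.
under eq_bigr do rewrite mulr_sumr.
rewrite exchange_big; apply: eq_bigr => i _ /=.
rewrite (partition_big (fun a : mdindex d n => a i) predT) //=.
apply: eq_bigr => j _; rewrite mulr_sumr.
apply: eq_big => [a|a /eqP <-]; first by rewrite inE.
by rewrite mulrC.
Qed.

Lemma sum_mass_weight_le W K L :
  polyplex W K -> (forall i j, 0 <= L i j) ->
  \sum_a K a * index_weight L a <= table_weight L.
Proof.
case=> _ Kh _ L0; rewrite sum_mass_weight; apply: ler_sum => i _.
by apply: ler_sum => j _; rewrite ler_piMr.
Qed.

Lemma weak_duality A K L W :
  polyplex W K -> contains A K -> hyperplane_cover A L -> W <= table_weight L.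
Proof.
move=> KW KA [L0 LA]; apply: le_trans (sum_mass_weight_le KW L0).
case: KW => K0 _ <-; apply: ler_sum => a _.
have [aA|aA] := boolP (a \in supp A); last by rewrite (mass_out KA aA) mul0r.
by rewrite ler_peMr // LA.
Qed.

Lemma polyplex_le1 K W a : (0 < d)%N -> polyplex W K -> K a <= 1.
Proof.
case: d K a => // d' K a _ [K0 Kh _].
apply: le_trans (Kh ord0 (a ord0)); rewrite (bigD1 a) ?inE //=.
by rewrite lerDl sumr_ge0.
Qed.

Lemma polyplex_weight_le K W : (0 < d)%N -> polyplex W K -> W <= n%:R.
Proof.
case: d K => // d' K _ [K0 Kh <-].
rewrite (partition_big (fun a : mdindex d'.+1 n => a ord0) predT) //=.
rewrite -[X in _ <= X%:R]card_ord -sumr_const; apply: ler_sum => j _.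
by apply: le_trans (Kh ord0 j); rewrite le_eqVlt; apply/orP; left; apply/eqP;
  apply: eq_bigl => a; rewrite inE.
Qed.

(** By Farkas' lemma, either a nonnegative combination gives the polyplex, or a separating point
    rescales to a strictly cheaper cover. *)
Lemma strong_duality A L :
  optimal_cover A L ->
  exists K, polyplex (table_weight L) K /\ contains A K.
Proof.
move=> [[L0 LA] Lopt].
(* Coordinates: [None] for the total weight, [Some (i, j)] for a hyperplane. Forms: [inl a] for a
   unit mass at [a], [inr p] for the slack in the bound of hyperplane [p]. *)
pose I := (mdindex d n + ('I_d * 'I_n))%type; pose J := option ('I_d * 'I_n)%type.
pose f (i : I) (j : J) : R :=
  match i, j with
  | inl a, Some (i, j) => (a i == j)%:R
  | inl _, None => 1
  | inr p, Some q => (p == q)%:R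
  | inr _, None => 0
  end.
pose g (j : J) : R := if j is Some _ then 1 else table_weight L.
pose s := [seq i <- index_enum I | if i is inl a then a \in supp A else true].
have us : uniq s by rewrite filter_uniq ?index_enum_uniq.
have tL0 : 0 <= table_weight L by rewrite sumr_ge0 // => i _; rewrite sumr_ge0.
have sumJ (F : J -> R) : \sum_j F j = F None + \sum_i \sum_j F (Some (i, j)).
  rewrite pair_big /= (bigD1 None) //=; congr (_ + _).
  rewrite (reindex_omap Some id) /=; last by case.
  by apply: eq_big => [[i j]|[i j]] //=; rewrite eqxx.
have [[k [k0 kE]]|[x [xf xg]]] := farkas f g us.
  have sumI (F : I -> R) : \sum_(i <- s) F i =
      \sum_(a in supp A) F (inl a) + \sum_p F (inr p).
    by rewrite big_filter big_sumType.
  pose K : mdmatrix R d n := [ffun a => if a \in supp A then k (inl a) else 0].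
  exists K; split; last first.
    by apply/subsetP=> a; rewrite inE ffunE; case: ifP; rewrite ?eqxx.
  split=> [a|i j|]; first by rewrite ffunE; case: ifP.
    have := kE (Some (i, j)); rewrite /g sumI => ->.
    rewrite -[leLHS]addr0 lerD ?sumr_ge0 // => [|p _]; last first.
      by rewrite mulr_ge0 ?ler0n.
    rewrite le_eqVlt; apply/orP; left; apply/eqP.
    rewrite big_mkcond [RHS]big_mkcond; apply: eq_bigr => a _.
    rewrite ffunE [a \in hyperplane _ _]inE /=.
    by case: (a i == j); case: (a \in _); rewrite ?mulr1 ?mulr0.
  have := kE None; rewrite /g sumI /= => ->.
  rewrite [X in _ = _ + X]big1 => [|p _]; last by rewrite mulr0.
  rewrite addr0 [RHS]big_mkcond; apply: eq_bigr => a _.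
  by rewrite ffunE mulr1.
exfalso; set x0 := x None.
have xE i j : x (Some (i, j)) <= 0.
  have /xf : inr (i, j) \in s by rewrite mem_filter mem_index_enum.
  rewrite (bigD1 (Some (i, j))) //= eqxx mulr1 big1 ?addr0 // => -[q|] /=.
    by rewrite (inj_eq Some_inj) eq_sym => /negPf ->; rewrite mulr0.
  by rewrite mulr0.
have x0_gt0 : 0 < x0.
  rewrite ltNge; apply/negP => x0_le0; move: xg; rewrite ltNge => /negP; apply.
  rewrite sumJ /g -[leRHS]addr0 lerD //; first by rewrite mulr_le0_ge0.
  by rewrite sumr_le0 // => i _; rewrite sumr_le0 // => j _; rewrite mulr1.
have := Lopt (\matrix_(i, j) (- x (Some (i, j)) / x0)).
have tE : table_weight (\matrix_(i, j) (- x (Some (i, j)) / x0)) =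
    - (\sum_i \sum_j x (Some (i, j))) / x0.
  rewrite /table_weight -sumrN mulr_suml; apply: eq_bigr => i _.
  by rewrite -sumrN mulr_suml; apply: eq_bigr => j _; rewrite mxE.
rewrite tE ler_pdivlMr // leNgt => /(_ _)/negP; apply.
  split=> [i j|a aA]; first by rewrite mxE divr_ge0 ?oppr_ge0 // ltW.
  have /xf : inl a \in s by rewrite mem_filter aA mem_index_enum.
  rewrite sumJ /= mulr1 -/x0 => xa.
  have -> : index_weight (\matrix_(i, j) (- x (Some (i, j)) / x0)) a =
    - (\sum_i x (Some (i, a i))) / x0.
    by rewrite -sumrN mulr_suml; apply: eq_bigr => i _; rewrite mxE.
  rewrite ler_pdivlMr // mul1r.
  suff : \sum_i \sum_j x (Some (i, j)) * (a i == j)%:R = \sum_i x (Some (i, a i)).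
    by move=> E; rewrite E in xa; lra.
  apply: eq_bigr => i _; rewrite (bigD1 (a i)) //= eqxx mulr1 big1 ?addr0 //.
  by move=> j; rewrite eq_sym => /negPf ->; rewrite mulr0.
move: xg; rewrite sumJ /g -/x0.
under eq_bigr do under eq_bigr do rewrite mulr1.
lra.
Qed.

End Duality.

(** * Optimal covers of an extremal matrix *)

Section ExtremalMatrices.

Variables (R : realFieldType) (d n : nat) (A : mdmatrix R d n) (delta : R).
Variable L : 'M[R]_(d, n).
Hypotheses (d_gt0 : (0 < d)%N) (hA : extremal A) (hdelta : deficiency A delta).
Hypothesis hL : optimal_cover A L.
Implicit Types (a b : mdindex d n) (i j : 'I_d).

Lemma cover_ge0 i m : 0 <= L i m.
Proof. by case: hL => -[]. Qed.

Lemma optimal_cover_weight : table_weight L = n%:R - delta.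
Proof.
have [W [[[K [KW KA]] Wmax] ->]] := hdelta.
rewrite subKr; apply/eqP; rewrite eq_le; apply/andP; split.
  by have [K' [K'W K'A]] := strong_duality hL; apply: Wmax K'W K'A.
exact: weak_duality KW KA hL.1.
Qed.

Lemma deficiency_gt0 : 0 < delta.
Proof.
have [W [[[K [KW KA]] _] ->]] := hdelta.
rewrite subr_gt0 lt_def (polyplex_weight_le d_gt0 KW) andbT.
apply/negP => /eqP nW; case: hA => _ noK _; apply: noK.
by exists K; rewrite /polydiagonal nW.
Qed.

Lemma extremal_zero : exists a, A a = 0.
Proof.
have [/existsP[a /eqP Aa]|] := boolP [exists a, A a == 0]; first by exists a.
rewrite negb_exists => /forallP Anz; case: hA => _ noK _; case: noK.
(* One unit of mass for each index of the main diagonal. *)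
pose K : mdmatrix R d n :=
  [ffun a => \sum_(k < n) (a == [ffun=> k] :> mdindex d n)%:R].
exists K; split; last by apply/subsetP=> a _; rewrite inE Anz.
have KE (P : pred (mdindex d n)) :
    \sum_(a | P a) K a = \sum_(k < n) (P [ffun=> k])%:R.
  under eq_bigr do rewrite ffunE.
  rewrite exchange_big; apply: eq_bigr => k _ /=.
  have [Pk|Pk] := boolP (P [ffun=> k]).
    rewrite (bigD1 [ffun=> k]) //= eqxx big1 ?addr0 // => a /andP[_ /negPf ->].
    by [].
  rewrite big1 // => a Pa.
  by case: eqP Pk => // <-; rewrite Pa.
split=> [a|i m|].
- by rewrite ffunE sumr_ge0.
- rewrite KE (bigD1 m) //= inE ffunE eqxx big1 ?addr0 // => k km.
  by rewrite inE ffunE (negPf km).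
- by rewrite KE sumr_const card_ord.
Qed.

(* Test the cover against the polydiagonal that appears once [a] is set to 1. *)
Lemma zero_weight_le a : A a = 0 -> index_weight L a <= 1 - delta.
Proof.
case: hA => _ _ ext Aa; have [K [Kn KA]] := ext a Aa.
have := sum_mass_weight_le Kn cover_ge0; rewrite optimal_cover_weight.
have Ka1 := polyplex_le1 a d_gt0 Kn.
case: Kn => K0 _ KE; rewrite -KE.
rewrite (bigD1 a) //= [X in _ <= X - _ -> _](bigD1 a) //=.
have : \sum_(b | b != a) K b <= \sum_(b | b != a) K b * index_weight L b.
  apply: ler_sum => b ba; have [bA|bA] := boolP (b \in supp (set_one A a)).
    rewrite ler_peMr //; case: hL => -[_ cov] _; apply: cov.
    by move: bA; rewrite !inE ffunE (negPf ba).
  by rewrite (mass_out KA bA) mul0r.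
move: (K0 a) Ka1 deficiency_gt0; move: (K a) (index_weight L a) => x w.
move: (\sum_(_ | _) _) (\sum_(_ | _) _) => s t x0 x1 d0 st le.
(* Mass away from [a] sits on weights of at least 1, so the whole shortfall [delta] is due to [a],
   whose mass is at most 1. *)
have h : delta <= x * (1 - w) by lra.
have w1 : 0 <= 1 - w by rewrite leNgt; apply/negP => w0; nra.
nra.
Qed.

Lemma supp_extremal a : (a \in supp A) = (1 <= index_weight L a).
Proof.
apply/idP/idP => [|wa]; first by case: hL => -[_ cov] _; apply: cov.
rewrite inE; apply/negP => /eqP /zero_weight_le le.
by have := deficiency_gt0; lra.
Qed.

Lemma extremal_eq0 a : index_weight L a < 1 -> A a = 0.
Proof.
move=> wa; apply/eqP; apply: contraTT wa => Aa.
by rewrite -leNgt -supp_extremal inE.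
Qed.

Lemma deficiency_le1 : delta <= 1.
Proof.
have [a /zero_weight_le wa] := extremal_zero.
have : 0 <= index_weight L a by rewrite sumr_ge0 // => i _; apply: cover_ge0.
lra.
Qed.

(* Otherwise subtract the minimum of the row from it and rescale: the weight
   would drop below the optimum. *)
Lemma cover_row_zero i : exists m, L i m = 0.
Proof.
have [a Aa] := extremal_zero.
have [m rho_min] : exists m, forall k, L i m <= L i k.
  by case: (arg_minP (L i) (erefl true : predT (a i))) => m _ mm; exists m => k; apply: mm.
exists m; set rho := L i m in rho_min *.
have rho0 : 0 <= rho by apply: cover_ge0.
have rho1 : 0 < 1 - rho.
  have : L i (a i) <= index_weight L a.
    by rewrite /index_weight (bigD1 i) //= lerDl sumr_ge0 // => j _; apply: cover_ge0.
  have := zero_weight_le Aa; have := rho_min (a i); have := deficiency_gt0; lra.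
pose L1 : 'M[R]_(d, n) :=
  \matrix_(j, k) ((L j k - (if j == i then rho else 0)) / (1 - rho)).
have sumi : \sum_j (if j == i then rho else 0) = rho by rewrite -big_mkcond big_pred1_eq.
(* Every index meets row [i] once, so it loses exactly [rho]; the rescaling sends [1 - rho] back to
   1. *)
have w1 b : index_weight L1 b = (index_weight L b - rho) / (1 - rho).
  under [LHS]eq_bigr do rewrite mxE.
  by rewrite -mulr_suml sumrB sumi.
have L1cov : hyperplane_cover A L1.
  split=> [j k|b bA].
    rewrite mxE divr_ge0 ?(ltW rho1) // subr_ge0.
    by case: eqP => [->|_]; [apply: rho_min|apply: cover_ge0].
  by rewrite w1 ler_pdivlMr // mul1r lerB // -supp_extremal.
have t1 : table_weight L1 = (table_weight L - n%:R * rho) / (1 - rho).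
  rewrite /table_weight.
  under [LHS]eq_bigr do under eq_bigr do rewrite mxE.
  under [LHS]eq_bigr do rewrite -mulr_suml sumrB sumr_const card_ord.
  rewrite -mulr_suml sumrB; congr ((_ - _) / _).
  by rewrite sumrMnl sumi mulr_natl.
(* The [n] entries of row [i] lose [n * rho] in all; optimality of [L] then reduces to
   [delta * rho <= 0]. *)
case: hL => _ /(_ _ L1cov); rewrite t1 optimal_cover_weight ler_pdivlMr //.
have := deficiency_gt0 => d0 le; apply/eqP; rewrite eq_le rho0 andbT.
rewrite -(ler_pM2l d0) mulr0; lra.
Qed.

Definition replace a i (q : 'I_n) : mdindex d n :=
  [ffun k => if k == i then q else a k].

Lemma index_weight_replace (M : 'M[R]_(d, n)) a i q :
  index_weight M (replace a i q) = index_weight M a - M i (a i) + M i q.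
Proof.
rewrite /index_weight (bigD1 i) //= [in RHS](bigD1 i) //= ffunE eqxx.
rewrite [RHS]addrC [_ + _ - _]addrAC subrr add0r; congr (_ + _); apply: eq_bigr => k /negPf ki.
by rewrite ffunE ki.
Qed.

(* Otherwise the entry [L i m] could be replaced by 0. *)
Lemma cover_entry_needed i m q : 0 < L i m -> L i q = 0 ->
  exists a, [/\ a i = m, 1 <= index_weight L a & A (replace a i q) = 0].
Proof.
move=> Lm Lq; pose P a := [&& a i == m, 1 <= index_weight L a & A (replace a i q) == 0].
have [/existsP[a /and3P[/eqP am wa /eqP Aa]]|] := boolP [exists a, P a].
  by exists a.
rewrite negb_exists => /forallP noP.
pose L1 : 'M[R]_(d, n) :=
  \matrix_(j, k) (if (j == i) && (k == m) then 0 else L j k).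
have L1cov : hyperplane_cover A L1.
  split=> [j k|a]; first by rewrite mxE; case: ifP => // _; apply: cover_ge0.
  rewrite supp_extremal => wa.
  have [am|am] := eqVneq (a i) m.
    (* Moved to column [q], whose entry is 0, the index stays in the support; so [a] has weight at
       least 1 even without [L i m]. *)
    have := noP a; rewrite /P am eqxx wa /= => /eqP Aaq.
    have : replace a i q \in supp A by rewrite inE; apply/eqP.
    rewrite supp_extremal => /le_trans -> //; apply: ler_sum => k _.
    rewrite mxE ffunE; have [-> /=|//] := eqVneq k i.
    by rewrite am eqxx Lq.
  rewrite (le_trans wa) // ler_sum // => k _; rewrite mxE.
  by case: eqP => [->|//]; rewrite (negPf am).
case: hL => _ /(_ _ L1cov); rewrite leNgt => /negP[].
rewrite /table_weight (bigD1 i) //= [ltRHS](bigD1 i) //=.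
rewrite ltr_leD //; last first.
  by apply: ler_sum => j /negPf ji; apply: ler_sum => k _; rewrite mxE ji.
rewrite (bigD1 m) //= [ltRHS](bigD1 m) //= mxE !eqxx /= ltr_leD //.
by apply: ler_sum => k /negPf km; rewrite mxE km andbF.
Qed.

(** If the entry is positive, moving some index from its column to a zero of the row lowers the
    weight from at least 1 to at most [1 - delta]. *)
Lemma cover_entry_gap i m : L i m < delta -> L i m = 0.
Proof.
move=> lt; apply/eqP; rewrite eq_le cover_ge0 andbT leNgt; apply/negP => L0.
have [q Lq] := cover_row_zero i.
have [a [am wa /zero_weight_le]] := cover_entry_needed L0 Lq.
by rewrite index_weight_replace am Lq; lra.
Qed.

End ExtremalMatrices.

(** * Relabelling, exchanging and extending polyplexes *)

Lemma sum_indicator (R : realFieldType) (T : finType) (P : pred T) (b : T) :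
  \sum_(a | P a) (a == b)%:R = (P b)%:R :> R.
Proof.
have [Pb|Pb] := boolP (P b).
  by rewrite (bigD1 b) //= eqxx big1 ?addr0 // => a /andP[_ /negPf ->].
by rewrite big1 // => a Pa; case: eqP Pb => // <-; rewrite Pa.
Qed.

Section PolyplexConstructions.

Variables (R : realFieldType) (d n : nat).
Implicit Types (K : mdmatrix R d n) (a b : mdindex d n).

Definition relabel (s : 'I_d -> {perm 'I_n}) a : mdindex d n :=
  [ffun i => s i (a i)].

Lemma relabel_polyplex W K (s : 'I_d -> {perm 'I_n}) :
  polyplex W K -> polyplex W [ffun a => K (relabel s a)].
Proof.
have bij : bijective (relabel s).
  exists (relabel (fun i => (s i)^-1)%g) => a; apply/ffunP => i; rewrite !ffunE.
    exact: permK.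
  exact: permKV.
case=> K0 Kh <-; split=> [a|i j|]; first by rewrite ffunE.
  under eq_bigr do rewrite ffunE.
  apply: le_trans (Kh i (s i j)); rewrite le_eqVlt; apply/orP; left; apply/eqP.
  rewrite [RHS](reindex (relabel s)); last exact: onW_bij.
  by apply: eq_bigl => a; rewrite !inE ffunE (inj_eq perm_inj).
rewrite [RHS](reindex (relabel s)) /=; last exact: onW_bij.
by apply: eq_bigr => a _; rewrite ffunE.
Qed.

Definition exchange K (t : R) a b a' b' : mdmatrix R d n :=
  [ffun x => K x + t * ((x == a')%:R + (x == b')%:R - (x == a)%:R - (x == b)%:R)].

(** In each direction [a'] and [b'] share out the coordinates of [a] and [b], so no hyperplane sum
    changes; the bound on [t] preserves nonnegativity. *)
Lemma exchange_polyplex W K t a b a' b' :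
    polyplex W K -> 0 <= t <= Num.min (K a) (K b) -> a != b ->
    (forall i, (a' i, b' i) = (a i, b i) \/ (a' i, b' i) = (b i, a i)) ->
  polyplex W (exchange K t a b a' b').
Proof.
case=> K0 Kh <- /andP[t0]; rewrite le_min => /andP[ta tb] ab swap.
have KE (P : pred (mdindex d n)) :
    (P a' + P b' = P a + P b)%N ->
    \sum_(x | P x) exchange K t a b a' b' x = \sum_(x | P x) K x.
  move=> PE; under eq_bigr do rewrite ffunE.
  rewrite big_split /= -mulr_sumr !sumrB big_split /= !sum_indicator.
  by rewrite -natrD PE natrD -addrA -opprD subrr mulr0 addr0.
split=> [x|i j|].
- rewrite ffunE; have := K0 x; have [->|xa] := eqVneq x a.
    rewrite (negPf ab) => _; case: eqP; case: eqP => _ _ /=; lra.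
  by have [->|xb] := eqVneq x b => Kx; case: eqP; case: eqP => _ _ /=; lra.
- rewrite KE // !inE.
  by case: (swap i) => -[-> ->] //; rewrite addnC.
- exact: KE.
Qed.

Definition embed a : mdindex d (n + 1) := [ffun i => lshift 1 (a i)].

Definition corner : mdindex d (n + 1) := [ffun=> rshift n ord0].

Definition extend K : mdmatrix R d (n + 1) :=
  [ffun x => (x == corner)%:R + \sum_(a | embed a == x) K a].

Lemma embed_inj : injective embed.
Proof.
by move=> a b /ffunP ab; apply/ffunP => i; have := ab i; rewrite !ffunE => /lshift_inj.
Qed.

Lemma embed_neq_corner a : (0 < d)%N -> embed a != corner.
Proof.
move=> d0; apply/eqP => /ffunP /(_ (Ordinal d0)); rewrite !ffunE => /eqP.
by rewrite eq_lrshift.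
Qed.

Lemma supp_extend K x :
  x \in supp (extend K) -> x = corner \/ exists2 a, a \in supp K & x = embed a.
Proof.
rewrite inE ffunE; have [->|_] := eqVneq x corner; first by left.
rewrite add0r => Kx; right; have [/existsP[a]|] :=
    boolP [exists a, (a \in supp K) && (x == embed a)].
  by case/andP=> aK /eqP ->; exists a.
rewrite negb_exists => /forallP none; case/eqP: Kx; apply: big1 => a /eqP ax.
by have := none a; rewrite -ax eqxx andbT inE negbK => /eqP.
Qed.

Lemma extend_embed K a : (0 < d)%N -> extend K (embed a) = K a.
Proof.
move=> d0; rewrite ffunE (negPf (embed_neq_corner a d0)) add0r.
by rewrite (big_pred1 a) // => b; rewrite (inj_eq embed_inj).
Qed.

Lemma extend_corner_ge1 W K : polyplex W K -> 1 <= extend K corner.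
Proof. by case=> K0 _ _; rewrite ffunE eqxx lerDl sumr_ge0. Qed.

(** Within the support, the new hyperplanes meet only the corner and the old ones only the embedded
    copy. *)
Lemma extend_polyplex W K : polyplex W K -> polyplex (W + 1) (extend K).
Proof.
case=> K0 Kh <-.
have KE (P : pred (mdindex d (n + 1))) :
    \sum_(x | P x) extend K x = (P corner)%:R + \sum_(a | P (embed a)) K a.
  under eq_bigr do rewrite ffunE.
  rewrite big_split /= sum_indicator (partition_big embed P) //=; congr (_ + _).
  apply: eq_bigr => x Px; apply: eq_bigl => a.
  by case: eqP => [->|]; rewrite ?Px ?andbF.
split=> [x|i j|].
- by rewrite ffunE addr_ge0 ?sumr_ge0.
- rewrite KE inE ffunE; case: (split_ordP j) => k ->.
    rewrite eq_rlshift add0r; apply: le_trans (Kh i k).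
    rewrite le_eqVlt; apply/orP; left; apply/eqP; apply: eq_bigl => a.
    by rewrite !inE ffunE (inj_eq (@lshift_inj _ _)).
  rewrite big_pred0 ?addr0 ?lern1 ?leq_b1 // => a.
  by rewrite inE ffunE eq_lrshift.
- by rewrite KE addrC.
Qed.

End PolyplexConstructions.

(** * Appending a nonnegative column of sum 1 *)

Section AppendedColumn.

Variables (R : realFieldType) (d n : nat) (A : mdmatrix R d n) (delta : R).
Variables (L : 'M[R]_(d, n)) (c : 'cV[R]_d).
Hypotheses (d_gt0 : (0 < d)%N) (hA : extremal A) (hdelta : deficiency A delta).
Hypothesis hL : optimal_cover A L.
Hypotheses (c_ge0 : forall i, 0 <= c i 0) (c_sum : \sum_i c i 0 = 1).

Let L' : 'M[R]_(d, n + 1) := row_mx L c.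
Let B := matrix_of_table L'.
Let new : 'I_(n + 1) := rshift n ord0.

Lemma index_weight_embed a : index_weight L' (embed a) = index_weight L a.
Proof. by apply: eq_bigr => i _; rewrite ffunE row_mxEl. Qed.

Lemma index_weight_corner : index_weight L' (corner d n) = 1.
Proof. by rewrite -c_sum; apply: eq_bigr => i _; rewrite ffunE row_mxEr. Qed.

Lemma append_cover : hyperplane_cover B L'.
Proof.
split=> [i j|a]; last by rewrite supp_matrix_of_table.
case: (split_ordP j) => k ->; rewrite ?row_mxEl ?row_mxEr ?ord1 //.
exact: cover_ge0 hL _ _.
Qed.

Lemma append_weight : table_weight L' = (n + 1)%:R - delta.
Proof.
rewrite natrD addrAC -(optimal_cover_weight hdelta hL) -c_sum -big_split /=.
apply: eq_bigr => i _; rewrite big_split_ord /= big_ord1 row_mxEr.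
by congr (_ + _); apply: eq_bigr => j _; rewrite row_mxEl.
Qed.

Lemma append_polyplex : exists K, polyplex (table_weight L') K /\ contains B K.
Proof.
have [K [KW KA]] := strong_duality hL.
exists (extend K); split.
  rewrite append_weight natrD addrAC -(optimal_cover_weight hdelta hL).
  exact: extend_polyplex.
apply/subsetP => x /supp_extend[->|[a aK ->]]; rewrite supp_matrix_of_table.
  by rewrite index_weight_corner.
by rewrite index_weight_embed -(supp_extremal d_gt0 hA hdelta hL) (subsetP KA).
Qed.

Lemma append_optimal : optimal_cover B L'.
Proof.
split=> [|M MB]; first exact: append_cover.
have [K [KW KB]] := append_polyplex; exact: weak_duality KW KB MB.
Qed.

Lemma append_deficiency_eq : deficiency B delta.
Proof.
exists (table_weight L'); split; last by rewrite append_weight subKr.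
split=> [|W K KW KB]; first exact: append_polyplex.
exact: weak_duality KW KB append_cover.
Qed.

Lemma append_no_polydiagonal : ~ exists K, polydiagonal K /\ contains B K.
Proof.
move=> [K [Kn KB]]; have := weak_duality Kn KB append_cover.
by rewrite append_weight; have := deficiency_gt0 d_gt0 hA hdelta; lra.
Qed.

(* Fill the new columns of [b] with the columns [p] of [A]; the resulting zero
   [a] of [A] gives a polydiagonal, whose mass at [a] is moved to [b] by an
   exchange with the corner. *)
Lemma completion_by_exchange (b : mdindex d (n + 1)) (p : 'I_d -> 'I_n) :
    index_weight L' b < 1 -> (forall i, b i = new -> L i (p i) = c i 0) ->
  exists K, polydiagonal K /\ contains (set_one B b) K.
Proof.
move=> wb pE.
(* In each direction [u] takes what [b] leaves of [embed a] and the corner. Thus [a] inherits the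
   weight of [b], and [u] has weight 1, like the corner. *)
pose a : mdindex d n :=
  [ffun i => match split (b i) with inl k => k | inr _ => p i end].
pose u : mdindex d (n + 1) :=
  [ffun i => if b i == new then lshift 1 (p i) else new].
have colP i : (exists2 k, b i = lshift 1 k & a i = k) \/ (b i = new /\ a i = p i).
  rewrite ffunE; case: split_ordP => k E; [left; exists k|right] => //.
  by rewrite E ord1.
have lnew k : lshift 1 k == new = false by rewrite eq_lrshift.
have wa : index_weight L a = index_weight L' b.
  apply: eq_bigr => i _; case: (colP i) => [[k -> ->]|[bi ->]].
    by rewrite row_mxEl.
  by rewrite (pE i bi) bi row_mxEr.
have wu : index_weight L' u = 1.
  rewrite -c_sum; apply: eq_bigr => i _; rewrite ffunE.
  case: eqP => [/pE|_]; first by rewrite row_mxEl.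
  by rewrite row_mxEr.
have Aa : A a = 0 by apply: (extremal_eq0 d_gt0 hA hdelta hL); rewrite wa.
have [_ _ /(_ a Aa)[K [Kn KA]]] := hA.
have K0 : 0 <= K a by case: Kn.
exists (exchange (extend K) (K a) (embed a) (corner d n) b u); split.
  rewrite /polydiagonal natrD; apply: exchange_polyplex.
  - exact: extend_polyplex.
  - rewrite K0 le_min extend_embed // lexx /=.
    by rewrite (le_trans (polyplex_le1 a d_gt0 Kn)) // (extend_corner_ge1 Kn).
  - exact: embed_neq_corner.
  move=> i; rewrite [embed a i]ffunE [corner d n i]ffunE [u i]ffunE.
  case: (colP i) => [[k bi ->]|[bi ->]].
    by left; rewrite bi lnew.
  by right; rewrite bi eqxx.
apply/subsetP => x; apply: contraTT; rewrite !inE !negbK ffunE => /eqP.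
have [->|xb] := eqVneq x b; first by move/eqP; rewrite oner_eq0.
move=> Bx; have wx : index_weight L' x < 1.
  by rewrite ltNge -supp_matrix_of_table inE Bx eqxx.
have xu : x != u by apply: contraTneq wx => ->; rewrite wu ltxx.
have xv : x != corner d n.
  by apply: contraTneq wx => ->; rewrite index_weight_corner ltxx.
rewrite /exchange ffunE (negPf xb) (negPf xu) (negPf xv) /=.
have [->|xa] := eqVneq x (embed a).
  by rewrite extend_embed //=; apply/eqP; ring.
rewrite !mulr0n !subr0 addr0 mulr0 addr0; apply/negPn/negP => xK.
have /supp_extend[xE|[e eK xE]] : x \in supp (extend K) by rewrite inE.
  by rewrite xE eqxx in xv.
have ea : e != a by apply: contraNneq xa => <-; rewrite xE.
have : e \in supp A.
  by have := subsetP KA e eK; rewrite !inE ffunE (negPf ea).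
rewrite (supp_extremal d_gt0 hA hdelta hL) -index_weight_embed -xE.
by rewrite leNgt wx.
Qed.

(* The weights of [b] leave less than [delta] outside [i], so its old columns
   carry weight 0 and [b] takes mass 1: exchanging in every direction the
   column of [b] with the new one turns [b] into the corner. *)
Lemma completion_by_relabelling (b : mdindex d (n + 1)) i j m :
    index_weight L' b < 1 -> i != j -> b i = new -> b j != new ->
    L j m = delta -> c i 0 = 1 - delta -> c j 0 = delta ->
  exists K, polydiagonal K /\ contains (set_one B b) K.
Proof.
move=> wb ij bi bj Ljm ci cj.
have L'0 := append_cover.1.
have d0 := deficiency_gt0 d_gt0 hA hdelta.
(* Row [i] contributes [1 - delta] to a weight below 1, so an old entry of [b] is below [delta],
   hence 0. *)
have Lb l k : b l = lshift 1 k -> L l k = 0.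
  move=> bl; apply: (cover_entry_gap d_gt0 hA hdelta hL).
  have li : l != i by apply/eqP => E; move: bl; rewrite E bi => /eqP; rewrite eq_rlshift.
  move: wb; rewrite /index_weight (bigD1 i) //= bi row_mxEr ci.
  rewrite (bigD1 l) //= bl row_mxEl.
  have : 0 <= \sum_(s < d | (s != i) && (s != l)) L' s (b s) by rewrite sumr_ge0.
  lra.
have [q bq] : exists q, b j = lshift 1 q.
  by case: (split_ordP (b j)) bj => k ->; [exists k|rewrite ord1 eqxx].
have Ljm0 : 0 < L j m by rewrite Ljm.
(* The entry [delta] of row [j] yields a zero [a] of [A] that shares column [q] with [b] in
   direction [j] and has weight at least [1 - delta]. *)
have [k [km wk Aa]] := cover_entry_needed d_gt0 hA hdelta hL Ljm0 (Lb j q bq).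
set a := replace k j q in Aa.
have wa : 1 - delta <= index_weight L a.
  by rewrite index_weight_replace km Ljm (Lb j q bq); lra.
have [_ _ /(_ a Aa)[K [Kn KA]]] := hA.
(* The identity in the directions where [b] already lies in the new column. *)
pose s l : {perm 'I_(n + 1)} := tperm new (b l).
exists [ffun x => extend K (relabel s x)]; split.
  rewrite /polydiagonal natrD; apply: relabel_polyplex; exact: extend_polyplex.
have sK x y : relabel s x = y -> x = relabel s y.
  by move=> <-; apply/ffunP => l; rewrite !ffunE tpermK.
apply/subsetP => x; rewrite inE ffunE => xK.
have /supp_extend[/sK xE|[e eK /sK xE]] : relabel s x \in supp (extend K).
- by rewrite inE.
- have -> : x = b by apply/ffunP => l; rewrite xE !ffunE tpermL.
  by rewrite inE ffunE eqxx oner_eq0.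
(* Only [a] may fall short of weight 1, by at most [delta], and it lies in column [q] in direction
   [j]. *)
have we : 1 <= index_weight L e + (if e j == q then delta else 0).
  have := subsetP KA e eK; rewrite inE ffunE; have [-> _|_] := eqVneq e a.
    by rewrite ffunE !eqxx; lra.
  move=> Ae; have : e \in supp A by rewrite inE.
  rewrite (supp_extremal d_gt0 hA hdelta hL).
  by case: ifP => _; have := d0; lra.
(* Where [e] shares its column with [b], relabelling replaces a zero entry by an appended one; in
   direction [j] this gains the missing [delta]. *)
have wx : 1 <= index_weight L' x.
  apply: le_trans we _.
  have <- : \sum_l (if (l == j) && (e j == q) then delta else 0) =
      (if e j == q then delta else 0).
    rewrite (bigD1 j) //= eqxx big1 ?addr0 // => l /negPf -> //.
  rewrite -big_split /=; apply: ler_sum => l _; rewrite xE !ffunE /s.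
  have [eb|eb] := eqVneq (lshift 1 (e l)) (b l).
    rewrite eb tpermR row_mxEr (Lb l (e l)) ?eb // add0r.
    have [->|//] := eqVneq l j; rewrite cj /=.
    by case: ifP => // _; apply: ltW.
  rewrite tpermD 1?eq_sym ?eq_lrshift // row_mxEl.
  have [lj|_] := eqVneq l j; last by rewrite addr0.
  case: eqP => [eq|_]; last by rewrite addr0.
  by move: eb; rewrite lj eq bq eqxx.
have : x \in supp B by rewrite supp_matrix_of_table.
rewrite !inE [set_one _ _ _]ffunE.
by case: (x =P b); rewrite ?oner_eq0.
Qed.

Lemma append_extremal :
    (forall b, index_weight L' b < 1 ->
       exists K, polydiagonal K /\ contains (set_one B b) K) ->
  extremal B.
Proof.
move=> compl; split=> [a||b Bb].
- by rewrite ffunE; case: ifP; [right|left].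
- exact: append_no_polydiagonal.
- by apply: compl; rewrite ltNge -supp_matrix_of_table inE Bb eqxx.
Qed.

End AppendedColumn.

(** * The three ways of appending a column *)

Theorem theorem6p3 (R : realFieldType) (d n : nat) (A : mdmatrix R d n)
    (delta : R) (L : 'M[R]_(d, n)) (c : 'cV[R]_d)
    (hA : extremal A) (hdelta : deficiency A delta) (hL : optimal_cover A L)
    (hc : append_index L c \/ append_unit c \/ append_deficiency L delta c) :
  let L' : 'M[R]_(d, n + 1) := row_mx L c in
  let B := matrix_of_table L' in
  [/\ optimal_cover B L', extremal B & deficiency B delta].
Proof.
move=> L' B.
have d0 : (0 < d)%N.
  case: hc => [[a [wa _]]|[[i _]|[i _]]]; last 2 first.
  - by apply: leq_ltn_trans (ltn_ord i).
  - by apply: leq_ltn_trans (ltn_ord i).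
  rewrite lt0n; apply: contra_eqN wa => /eqP d0.
  rewrite /index_weight big1 ?(eq_sym 0) ?oner_eq0 // => i.
  by have /lt0n_neq0/eqP/(_ d0) := leq_ltn_trans (leq0n i) (ltn_ord i).
have del0 := deficiency_gt0 d0 hA hdelta.
have del1 := deficiency_le1 d0 hA hdelta hL.
suff [c0 c1 compl] : [/\ forall i, 0 <= c i 0, \sum_i c i 0 = 1 &
    forall b, index_weight L' b < 1 ->
      exists K, polydiagonal K /\ contains (set_one B b) K].
  split; first exact: (append_optimal d0 hA hdelta hL).
    exact: (append_extremal d0 hA hdelta hL).
  exact: (append_deficiency_eq d0 hA hdelta hL).
have rowz := cover_row_zero d0 hA hdelta hL.
case: hc => [[a [wa cE]]|[[i cE]|[i [j [ij [m Ljm] cE]]]]].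
- have c0 i : 0 <= c i 0 by rewrite cE; apply: cover_ge0 hL _ _.
  have c1 : \sum_i c i 0 = 1 by rewrite -wa; apply: eq_bigr => i _.
  split=> // b wb; apply: (completion_by_exchange d0 hA hdelta hL c1 (p := a)) => //.
- have c0 k : 0 <= c k 0 by rewrite cE; case: ifP.
  have c1 : \sum_i c i 0 = 1.
    by under eq_bigr do rewrite cE; rewrite -big_mkcond big_pred1_eq.
  split=> // b wb.
  (* In row [i] the appended 1 alone would give [b] weight 1, so [b] meets the new column only in
     appended zeros, and each row of [L] has a 0 to match. *)
  have bnew k : b k = rshift n ord0 -> c k 0 = 0.
    rewrite cE; case: eqP => // ->  bi; move: wb; rewrite ltNge => /negP[].
    rewrite /index_weight (bigD1 i) //= bi row_mxEr cE eqxx lerDl sumr_ge0 // => l _.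
    exact: (append_cover hL c0).1.
  have [p pE] := fin_all_exists rowz.
  by apply: (completion_by_exchange d0 hA hdelta hL c1 (p := p)) => // k /bnew ->.
have ci : c i 0 = 1 - delta by rewrite cE eqxx.
have cj : c j 0 = delta by rewrite cE eq_sym (negPf ij) eqxx.
have cl l : l != i -> l != j -> c l 0 = 0 by move=> /negPf li /negPf lj; rewrite cE li lj.
have c0 k : 0 <= c k 0 by rewrite cE; case: ifP => _; [lra|case: ifP => _; lra].
have c1 : \sum_i c i 0 = 1.
  rewrite (bigD1 i) //= (bigD1 j) 1?eq_sym //= ci cj big1 => [|l /andP[]]; first lra.
  exact: cl.
split=> // b wb.
(* An index of weight below 1 cannot take both [1 - delta] and [delta] from the new column. *)
have [bi|bi] := eqVneq (b i) (rshift n ord0).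
  apply: (completion_by_relabelling d0 hA hdelta hL c0 wb ij bi _ Ljm ci cj).
  apply/eqP => bj; move: wb; rewrite ltNge => /negP[].
  rewrite /index_weight (bigD1 i) //= (bigD1 j) 1?eq_sym //= bi bj !row_mxEr ci cj.
  rewrite addrA subrK lerDl sumr_ge0 // => l _; exact: (append_cover hL c0).1.
(* Outside row [i] the appended entries occur in [L]: [delta] in column [m] of row [j], and 0 in
   every other row. *)
have [p pE] : exists p : 'I_d -> 'I_n, forall l, l != i -> L l (p l) = c l 0.
  apply: (fin_all_exists (P := fun l k => l != i -> L l k = c l 0)) => l.
  have [->|lj] := eqVneq l j; first by exists m; rewrite cj.
  by have [k k0] := rowz l; exists k => li; rewrite cl.
apply: (completion_by_exchange d0 hA hdelta hL c1 (p := p)) => // l bl.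
by apply: pE; apply: contraNneq bi => <-; rewrite bl.
Qed.
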